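(* Let $n\ge 12$, let $b_{\mathrm{max}}=\frac{1}{4n}$, and let $\tilde b_{\mathrm{max}}=\frac{1}{3(n-6)^2}$ if $n\ge13$ and $\tilde b_{\mathrm{max}}=\frac1{115}$ if $n=12$. Then $\tilde{\mathcal{C}}(\tilde{b}_{\mathrm{max}}) = \mathcal{C}(b_{\mathrm{max}})$.
   Context: An algebraic curvature tensor on $\mathbb{R}^n$ is a four-linear form $R_{ijkl}$ with $R_{ijkl}=-R_{jikl}=-R_{ijlk}=R_{klij}$ and the first Bianchi identity ($R_{1212}$ is the sectional curvature of the plane spanned by orthonormal $e_1,e_2$); $\mathrm{Ric}(R)_{ik}=\sum_p R_{ipkp}$, $\mathrm{scal}(R)=\sum_i \mathrm{Ric}(R)_{ii}$. Kulkarni-Nomizu product: $(A \odot B)_{ijkl} = A_{ik} B_{jl} - A_{il} B_{jk} - A_{jk} B_{il} + A_{jl} B_{ik}$. For real $a,b$, $\ell_{a,b}(S) = S + b \, \mathrm{Ric}(S) \odot \mathrm{id} + \frac{1}{n} (a-b) \, \mathrm{scal}(S) \, \mathrm{id} \odot \mathrm{id}$. For tensors $T$ having all algebraic properties of a curvature tensor except possibly the first Bianchi identity: $T\ge 0$ means $T(\varphi,\bar\varphi)\ge0$ for every complex two-form $\varphi$; $T\in\mathrm{PIC}$ means $T_{1313}+T_{1414}+T_{2323}+T_{2424}+2T_{1342}+2T_{1423}\ge 0$ for every orthonormal four-frame. Definition of $\mathcal{C}(b)$, $0<b\le b_{\mathrm{max}}$: put $a = \frac{(2+(n-2)b)^2}{2(2+(n-3)b)}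 b$, $\gamma = \frac{b}{2+(n-3)b}$, and $\omega>0$ with $\omega^2 = \frac{27(2+(n-2)b)}{8} \cdot \frac{(1-4(n-2)b^2)^4(1+(n-2)b)^2}{n^2b^2(2+(n-3)b)^2}$. $\mathcal{E}(b)$ is the set of all algebraic curvature tensors $S$ for which there exists a tensor $T$ such that: (i) $T$ satisfies all the algebraic properties of a curvature tensor except for the first Bianchi identity, and $T\ge0$; (ii) $S-T\in\mathrm{PIC}$; (iii) $\mathrm{Ric}(S)_{11}+\mathrm{Ric}(S)_{22}+\frac{2\gamma}{n}\mathrm{scal}(S)\ge0$ for every orthonormal pair $\{e_1,e_2\}$; (iv) for every orthonormal frame $\{e_1,\dots,e_n\}$, $\mathrm{Ric}(S)_{22}-\mathrm{Ric}(S)_{11} \leq \omega^{1/2} \mathrm{scal}(S)^{1/2} \big( \sum_{p=3}^n (T_{1p1p}+T_{2p2p}) \big)^{1/2} + 2(n-2)b \sum_{p=3}^n (T_{1p1p}+T_{2p2p})$. Then $\mathcal{C}(b)=\ell_{a,b}(\mathcal{E}(b))$. Definition of $\tilde{\mathcal{C}}(b)$, $0<b\le\tilde b_{\mathrm{max}}$: put $2a=2b+(n-2)b^2$. $\tilde{\mathcal{E}}(b)$ is the set of all algebraic curvature tensors $S$ such that $\ell_{a,b}(S)\in\mathcal{C}(b_{\mathrm{max}})$ and $S_{1313}+\lambda^2 S_{1414}+S_{2323}+\lambda^2 S_{2424}-2\lambda S_{1234} + \sqrt{2a}\,(1-\lambda^2)(\mathrm{Ric}(S)_{11}+\mathrm{Ric}(S)_{22})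 \ge 0$ for every orthonormal four-frame $\{e_1,e_2,e_3,e_4\}$ and every $\lambda\in[0,1]$. Then $\tilde{\mathcal{C}}(b)=\ell_{a,b}(\tilde{\mathcal{E}}(b))$. *)

(* Defs.v *)
From HB Require Import structures.
From mathcomp Require Import all_boot all_order all_algebra.
From mathcomp Require Import complex.
From mathcomp Require Import classical_sets reals.

Set Implicit Arguments.
Unset Strict Implicit.
Unset Printing Implicit Defensive.

Import Order.TTheory GRing.Theory Num.Theory.
Local Open Scope ring_scope.
Local Open Scope classical_set_scope.
Local Open Scope complex_scope.

Section Tensors.
Variables (R : realType) (n : nat).

Definition form2 := 'rV[R]_n -> 'rV[R]_n -> R.
Definition form4 := 'rV[R]_n -> 'rV[R]_n -> 'rV[R]_n -> 'rV[R]_n -> R.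

Definition euclid : form2 := fun x y => \sum_(i < n) x 0 i * y 0 i.

Definition basis (i : 'I_n) : 'rV[R]_n := delta_mx 0 i.

Definition four_linear (S : form4) : Prop :=
  [/\ forall y z w, scalar (fun x => S x y z w),
      forall x z w, scalar (fun y => S x y z w),
      forall x y w, scalar (fun z => S x y z w)
    & forall x y z, scalar (fun w => S x y z w)].

(* All algebraic properties of a curvature tensor except the first Bianchi
   identity. *)
Definition curvature_like (S : form4) : Prop :=
  [/\ four_linear S,
      forall x y z w, S x y z w = - S y x z w,
      forall x y z w, S x y z w = - S x y w z
    & forall x y z w, S x y z w = S z w x y].

Definition first_bianchi (S : form4) : Prop :=
  forall x y z w, S x y z w + S y z x w + S z x y w = 0.

Definition curvature_tensor (S : form4) : Prop :=
  curvature_like S /\ first_bianchi S.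

Definition Ric (S : form4) : form2 :=
  fun x z => \sum_(p < n) S x (basis p) z (basis p).

Definition scal (S : form4) : R := \sum_(i < n) Ric S (basis i) (basis i).

Definition kulkarni_nomizu (A B : form2) : form4 := fun x y z w =>
  A x z * B y w - A x w * B y z - A y z * B x w + A y w * B x z.

Definition form4_sub (S T : form4) : form4 :=
  fun x y z w => S x y z w - T x y z w.

Definition ell (a b : R) (S : form4) : form4 := fun x y z w =>
  S x y z w + b * kulkarni_nomizu (Ric S) euclid x y z w
  + n%:R^-1 * (a - b) * scal S * kulkarni_nomizu euclid euclid x y z w.

(* Frames are numbered from 1: only e 1, ..., e k matter. *)
Definition orthonormal_frame (k : nat) (e : nat -> 'rV[R]_n) : Prop :=
  forall i j : nat, (1 <= i <= k)%N -> (1 <= j <= k)%N ->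
    euclid (e i) (e j) = (i == j)%:R.

Definition at2 (A : form2) (e : nat -> 'rV[R]_n) (i j : nat) : R :=
  A (e i) (e j).

Definition at4 (S : form4) (e : nat -> 'rV[R]_n) (i j k l : nat) : R :=
  S (e i) (e j) (e k) (e l).

(* The order on R[i] satisfies 0 <= z iff z is real and nonnegative; for
   curvature-like T the value T(phi, conj phi) is real. Summing over all index
   pairs rather than over i < j and k < l multiplies it by 4. *)
Definition tensor_nonneg (T : form4) : Prop :=
  forall phi : 'M[R[i]]_n, phi^T = - phi ->
    0 <= \sum_(i < n) \sum_(j < n) \sum_(k < n) \sum_(l < n)
           phi i j * (phi k l)^*
           * (T (basis i) (basis j) (basis k) (basis l))%:C.

Definition PIC (T : form4) : Prop :=
  forall e, orthonormal_frame 4 e ->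
    0 <= at4 T e 1 3 1 3 + at4 T e 1 4 1 4 + at4 T e 2 3 2 3 + at4 T e 2 4 2 4
         + 2 * at4 T e 1 3 4 2 + 2 * at4 T e 1 4 2 3.

Definition coneC_a (b : R) : R :=
  (2 + (n%:R - 2) * b) ^+ 2 / (2 * (2 + (n%:R - 3) * b)) * b.

Definition coneC_gamma (b : R) : R := b / (2 + (n%:R - 3) * b).

Definition coneC_omega (b : R) : R :=
  Num.sqrt (27 * (2 + (n%:R - 2) * b) / 8
    * ((1 - 4 * (n%:R - 2) * b ^+ 2) ^+ 4 * (1 + (n%:R - 2) * b) ^+ 2
       / (n%:R ^+ 2 * b ^+ 2 * (2 + (n%:R - 3) * b) ^+ 2))).

Definition sum_sect12 (T : form4) (e : nat -> 'rV[R]_n) : R :=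
  \sum_(3 <= p < n.+1) (at4 T e 1 p 1 p + at4 T e 2 p 2 p).

(* Both square roots in the last clause have nonnegative arguments: scal S >= 0
   by averaging the third clause, and sum_sect12 T e >= 0 as T >= 0. *)
Definition coneE (b : R) : set form4 := [set S |
  curvature_tensor S /\
  exists T : form4,
    [/\ curvature_like T /\ tensor_nonneg T,
        PIC (form4_sub S T),
        forall e, orthonormal_frame 2 e ->
          0 <= at2 (Ric S) e 1 1 + at2 (Ric S) e 2 2
               + 2 * coneC_gamma b / n%:R * scal S
      & forall e, orthonormal_frame n e ->
          at2 (Ric S) e 2 2 - at2 (Ric S) e 1 1
          <= Num.sqrt (coneC_omega b) * Num.sqrt (scal S)
               * Num.sqrt (sum_sect12 T e)
             + 2 * (n%:R - 2) * b * sum_sect12 T e]].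

Definition coneC (b : R) : set form4 := ell (coneC_a b) b @` coneE b.

Definition b_max : R := 1 / (4 * n%:R).

Definition tilde_a (b : R) : R := (2 * b + (n%:R - 2) * b ^+ 2) / 2.

Definition tilde_coneE (b : R) : set form4 := [set S |
  [/\ curvature_tensor S,
      coneC b_max (ell (tilde_a b) b S)
    & forall e (lam : R), orthonormal_frame 4 e -> 0 <= lam <= 1 ->
        0 <= at4 S e 1 3 1 3 + lam ^+ 2 * at4 S e 1 4 1 4
             + at4 S e 2 3 2 3 + lam ^+ 2 * at4 S e 2 4 2 4
             - 2 * lam * at4 S e 1 2 3 4
             + Num.sqrt (2 * tilde_a b) * (1 - lam ^+ 2)
               * (at2 (Ric S) e 1 1 + at2 (Ric S) e 2 2)]].

Definition tilde_coneC (b : R) : set form4 :=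
  ell (tilde_a b) b @` tilde_coneE b.

(* Meant for n >= 12. *)
Definition tilde_b_max : R :=
  if n == 12%N then 1 / 115 else 1 / (3 * (n%:R - 6) ^+ 2).

End Tensors.

(* Main.v *)
(* Since [ell] is a one-parameter-per-component rescaling of the scalar and
   traceless Ricci parts, an element of [coneC b_max] is both [ell a b U] with
   [U] in [coneE b_max] and [ell al be S] with [S := ell a' b' U], so only the
   last condition of [tilde_coneE] has to be checked for [S].

   [U] is PIC, because [T >= 0] implies PIC.  Put
   [h(x) := U(e1,x,e1,x) + U(e2,x,e2,x)].  Averaging the PIC inequalities of the
   frames [e1, e2, e3, lam e4 +- sqrt(1-lam^2) e_p] gives
   [h(e3) + lam^2 h(e4) - 2 lam U_1234 >= - (1-lam^2) h(e_p)] for [p >= 5], and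
   summing over [p] bounds the left-hand side below by
   [- (1-lam^2) (Ric_11 + Ric_22 - 2 U_1212) / (n-4)].  Averaging PIC over the
   frames [e1, e_q, e2, e_p] bounds [U_1212] below by Ricci and scalar
   curvature.  Together with the pinching of [Ric U] the claim is then an
   inequality between explicit functions of [n]. *)
Require Import Defs.
From mathcomp Require Import all_boot all_order all_algebra.
From mathcomp Require Import complex.
From mathcomp Require Import classical_sets reals.
From mathcomp Require Import boolp ring lra zify.

Set Implicit Arguments.
Unset Strict Implicit.
Unset Printing Implicit Defensive.

Import Order.TTheory GRing.Theory Num.Theory.
Local Open Scope ring_scope.

(** * Multilinear forms, traces in orthonormal frames, extension of frames *)

Section Forms.
Variables (R : realType) (n : nat).
Implicit Types (x y z w : 'rV[R]_n) (S T U : form4 R n) (e : nat -> 'rV[R]_n).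

Lemma scalar_form0 (f : 'rV[R]_n -> R) : scalar f -> f 0 = 0.
Proof.
by move=> lf; have := lf (-1) 0 0; rewrite scaler0 addr0 mulN1r addNr.
Qed.

Lemma scalar_formD (f : 'rV[R]_n -> R) x y : scalar f -> f (x + y) = f x + f y.
Proof. by move=> lf; rewrite -[x]scale1r lf mul1r scale1r. Qed.

Lemma scalar_formZ (f : 'rV[R]_n -> R) c x : scalar f -> f (c *: x) = c * f x.
Proof. by move=> lf; rewrite -[c *: x]addr0 lf scalar_form0 // addr0. Qed.

Lemma scalar_formE (f : 'rV[R]_n -> R) x :
  scalar f -> f x = \sum_(i < n) x 0 i * f (basis R i).
Proof.
move=> lf; rewrite {1}[x]row_sum_delta.
rewrite (big_morph f (fun x y => scalar_formD x y lf) (scalar_form0 lf)).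
by apply: eq_bigr => i _; rewrite scalar_formZ.
Qed.

Definition bilinear2 (f : form2 R n) : Prop :=
  (forall y, scalar (f ^~ y)) /\ (forall x, scalar (f x)).

Lemma bilinear2E (f : form2 R n) x y : bilinear2 f ->
  f x y = \sum_(i < n) \sum_(j < n) x 0 i * y 0 j * f (basis R i) (basis R j).
Proof.
move=> [fl fr]; rewrite (scalar_formE x (fl y)); apply: eq_bigr => i _.
rewrite (scalar_formE y (fr _)) big_distrr /=; apply: eq_bigr => j _.
by rewrite mulrA.
Qed.

Lemma euclid_bilinear : bilinear2 (@euclid R n).
Proof.
split=> [y a u v|x a u v] /=; rewrite /euclid big_distrr /= -big_split /=;
  apply: eq_bigr => i _; rewrite !mxE; ring.
Qed.

Lemma euclidC x y : euclid x y = euclid y x.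
Proof. by apply: eq_bigr => i _; rewrite mulrC. Qed.

Lemma euclid_basis x i : euclid x (basis R i) = x 0 i.
Proof.
rewrite /euclid (bigD1 i) //= big1 ?addr0 => [|j ji];
  by rewrite !mxE ?eqxx ?mulr1 //= (negPf ji) mulr0.
Qed.

Lemma sum_basisl (f : form2 R n) x z : bilinear2 f ->
  \sum_(p < n) f x (basis R p) * euclid (basis R p) z = f x z.
Proof.
move=> [_ fr]; rewrite [RHS](scalar_formE z (fr x)); apply: eq_bigr => i _.
by rewrite euclidC euclid_basis mulrC.
Qed.

Lemma sum_basisr (f : form2 R n) x z : bilinear2 f ->
  \sum_(p < n) f (basis R p) z * euclid x (basis R p) = f x z.
Proof.
move=> [fl _]; rewrite [RHS](scalar_formE x (fl z)); apply: eq_bigr => i _.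
by rewrite euclid_basis mulrC.
Qed.

Lemma sum_euclid_basis : \sum_(p < n) euclid (basis R p) (basis R p) = n%:R.
Proof.
rewrite (eq_bigr (fun=> 1)) ?sumr_const ?card_ord // => i _.
by rewrite euclid_basis mxE !eqxx.
Qed.

(** A square matrix with orthonormal rows has orthonormal columns. *)
Lemma frame_completeness e (i j : 'I_n) : orthonormal_frame n e ->
  \sum_(1 <= p < n.+1) e p 0 i * e p 0 j = (i == j)%:R.
Proof.
move=> oe; pose E : 'M[R]_n := \matrix_(p < n) e p.+1.
have EE : E *m E^T = 1%:M.
  apply/matrixP => p q; rewrite !mxE -[RHS](oe p.+1 q.+1) ?ltnS ?ltn_ord //.
  by apply: eq_bigr => k _; rewrite !mxE.
have /matrixP/(_ i j) := mulmx1C EE; rewrite !mxE => <-.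
by rewrite big_add1 big_mkord; apply: eq_bigr => p _; rewrite !mxE.
Qed.

(** Lets [Ric] and [scal], defined through the standard basis, be computed in any orthonormal
    frame. *)
Lemma trace_frame (f : form2 R n) e : bilinear2 f -> orthonormal_frame n e ->
  \sum_(i < n) f (basis R i) (basis R i) = \sum_(1 <= p < n.+1) f (e p) (e p).
Proof.
move=> bf oe; under [RHS]eq_bigr do rewrite bilinear2E //.
rewrite exchange_big /=; apply: eq_bigr => i _.
rewrite exchange_big /= (bigD1 i) //= -[LHS]addr0; congr (_ + _).
  by rewrite -big_distrl /= frame_completeness // eqxx mul1r.
rewrite big1 // => j ji; rewrite -big_distrl /= frame_completeness //.
by rewrite eq_sym (negPf ji) mul0r.
Qed.

(** The matrix with columns [e 1], ..., [e k] has rank less than [n], so its left kernel contains a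
    nonzero vector, which is then normalised. *)
Lemma unit_orthogonal (k : nat) e : (k < n)%N ->
  exists2 v : 'rV[R]_n, euclid v v = 1 &
    forall i, (1 <= i <= k)%N -> euclid (e i) v = 0.
Proof.
move=> kn; pose A : 'M[R]_(n, k) := \matrix_(i < n, j < k) e j.+1 0 i.
have /rowV0Pn[u /sub_kermxP uA u0] : kermx A != 0.
  rewrite -mxrank_eq0 mxrank_ker subn_eq0 -ltnNge.
  by rewrite (leq_ltn_trans (rank_leq_col A)).
have uu : 0 < euclid u u.
  rewrite lt_neqAle sumr_ge0 ?andbT => [|i _]; last by rewrite -expr2 sqr_ge0.
  apply: contra u0 => /eqP/esym/psumr_eq0P u_eq0.
  apply/eqP/rowP => i; rewrite mxE; apply/eqP.
  by rewrite -sqrf_eq0 expr2 u_eq0 // => j _; rewrite -expr2 sqr_ge0.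
have [el er] := euclid_bilinear.
exists ((Num.sqrt (euclid u u))^-1 *: u) => [|i /andP[i1 ik]].
  rewrite (scalar_formZ _ _ (el _)) (scalar_formZ _ _ (er _)) mulrA -expr2.
  by rewrite exprVn sqr_sqrtr ?ltW // mulVf ?gt_eqF.
rewrite (scalar_formZ _ _ (er _)).
suff -> : euclid (e i) u = 0 by rewrite mulr0.
have ik' : (i.-1 < k)%N by case: i i1 ik.
have /rowP/(_ (Ordinal ik')) := uA; rewrite !mxE => uA0; rewrite -[RHS]uA0.
by apply: eq_bigr => j _; rewrite !mxE /= prednK // mulrC.
Qed.

(** Induction on the codimension [n - k]. The last clause of [tilde_coneE] concerns four-frames,
    while the averaging below runs over complete frames. *)
Lemma orthonormal_frame_extend (k : nat) e : (k <= n)%N ->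
  orthonormal_frame k e ->
  exists2 e', orthonormal_frame n e' & forall i, (i <= k)%N -> e' i = e i.
Proof.
move=> kn; have [d dE] : {d | d = n - k}%N by exists (n - k)%N.
elim: d k kn e dE => [|d IHd] k kn e dE oe.
  have kE : k = n by apply/eqP; rewrite eqn_leq kn -subn_eq0 -dE.
  by move: oe; rewrite kE => oe; exists e.
have {}kn : (k < n)%N by rewrite -subn_gt0 -dE.
have [v vv ev] := unit_orthogonal e kn.
have [||e' oe' e'E] := IHd k.+1 kn (fun i => if i == k.+1 then v else e i).
- by rewrite subnS -dE.
- move=> i j /andP[i1]; rewrite leq_eqVlt ltnS => ik /andP[j1].
  rewrite leq_eqVlt ltnS => jk.
  case: eqP ik => [->|/= _ ik]; case: eqP jk => [->|/= ne jk].
  + by rewrite eqxx.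
  + by rewrite euclidC ev ?j1 // eq_sym; case: eqP.
  + rewrite ev ?i1 //; case: eqP => // ik1.
    by move: ik; rewrite ik1 ltnn.
  + by rewrite oe ?i1 ?j1.
- exists e' => // i ik; rewrite e'E ?leqW //.
  by case: eqP => // ik1; move: ik; rewrite ik1 ltnn.
Qed.

End Forms.

(** * Ricci and scalar curvature of [ell a b S], and composition of the maps [ell] *)

Section Curvature.
Variables (R : realType) (n : nat).
Implicit Types (x y z w : 'rV[R]_n) (A B : form2 R n) (S T U : form4 R n).
Implicit Types (e : nat -> 'rV[R]_n) (a b c : R).

Lemma Ric_bilinear S : four_linear S -> bilinear2 (Ric S).
Proof.
move=> [l1 _ l3 _]; split=> [y a u v|x a u v] /=;
  rewrite /Ric big_distrr /= -big_split /=; apply: eq_bigr => i _.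
- exact: l1.
- exact: l3.
Qed.

Lemma RicC S x z : curvature_like S -> Ric S x z = Ric S z x.
Proof. by move=> [_ _ _ pairC]; apply: eq_bigr => i _; rewrite pairC. Qed.

Lemma Ric_frame S e x z : four_linear S -> orthonormal_frame n e ->
  Ric S x z = \sum_(1 <= p < n.+1) S x (e p) z (e p).
Proof.
move=> [_ l2 _ l4] oe.
by rewrite -(trace_frame (f := fun y w => S x y z w) _ oe).
Qed.

Lemma scal_frame S e : four_linear S -> orthonormal_frame n e ->
  scal S = \sum_(1 <= p < n.+1) Ric S (e p) (e p).
Proof. by move=> lS oe; rewrite -trace_frame //; apply: Ric_bilinear. Qed.

Lemma kulkarni_nomizu_curvature A B :
  bilinear2 A -> bilinear2 B ->
  (forall x y, A x y = A y x) -> (forall x y, B x y = B y x) ->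
  curvature_tensor (kulkarni_nomizu A B).
Proof.
move=> [Al Ar] [Bl Br] AC BC; split; [split; [split|..]|].
- move=> y z w a u v /=; rewrite /kulkarni_nomizu !(Al _ a u v) !(Bl _ a u v).
  by ring.
- move=> x z w a u v /=; rewrite /kulkarni_nomizu !(Al _ a u v) !(Bl _ a u v).
  by ring.
- move=> x y w a u v /=; rewrite /kulkarni_nomizu !(Ar _ a u v) !(Br _ a u v).
  by ring.
- move=> x y z a u v /=; rewrite /kulkarni_nomizu !(Ar _ a u v) !(Br _ a u v).
  by ring.
- by move=> x y z w; rewrite /kulkarni_nomizu; ring.
- by move=> x y z w; rewrite /kulkarni_nomizu; ring.
- move=> x y z w; rewrite /kulkarni_nomizu.
  rewrite (AC z x) (AC w y) (AC z y) (AC w x).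
  by rewrite (BC z x) (BC w y) (BC z y) (BC w x); ring.
- move=> x y z w; rewrite /kulkarni_nomizu.
  rewrite (AC y x) (AC z x) (AC z y) (BC y x) (BC z x) (BC z y); ring.
Qed.

Lemma curvature_tensor_comb S T U b c :
  curvature_tensor S -> curvature_tensor T -> curvature_tensor U ->
  curvature_tensor (fun x y z w =>
    S x y z w + b * T x y z w + c * U x y z w).
Proof.
move=> [[[S1 S2 S3 S4] Sa Sb Sc] SB] [[[T1 T2 T3 T4] Ta Tb Tc] TB].
move=> [[[U1 U2 U3 U4] Ua Ub Uc] UB].
split; [split; [split|..]|].
- by move=> y z w a u v /=; rewrite (S1 y z w) (T1 y z w) (U1 y z w); ring.
- by move=> x z w a u v /=; rewrite (S2 x z w) (T2 x z w) (U2 x z w); ring.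
- by move=> x y w a u v /=; rewrite (S3 x y w) (T3 x y w) (U3 x y w); ring.
- by move=> x y z a u v /=; rewrite (S4 x y z) (T4 x y z) (U4 x y z); ring.
- by move=> x y z w; rewrite Sa Ta Ua; ring.
- by move=> x y z w; rewrite Sb Tb Ub; ring.
- by move=> x y z w; rewrite Sc Tc Uc.
- move=> x y z w.
  transitivity ((S x y z w + S y z x w + S z x y w)
    + b * (T x y z w + T y z x w + T z x y w)
    + c * (U x y z w + U y z x w + U z x y w)); first by ring.
  by rewrite SB TB UB; ring.
Qed.

Lemma ell_curvature a b S : curvature_tensor S -> curvature_tensor (ell a b S).
Proof.
move=> cS; have [[lS _ _ _] _] := cS.
have eb := @euclid_bilinear R n; have ec := @euclidC R n.
apply: curvature_tensor_comb => //; apply: kulkarni_nomizu_curvature => //.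
- exact: Ric_bilinear.
- by move=> x y; apply: RicC; case: cS.
Qed.

Lemma Ric_kulkarni_nomizu A x z : bilinear2 A ->
  Ric (kulkarni_nomizu A (@euclid R n)) x z =
    (n%:R - 2) * A x z
    + (\sum_(p < n) A (basis R p) (basis R p)) * euclid x z.
Proof.
move=> bA; rewrite /Ric /kulkarni_nomizu !big_split /= !sumrN.
rewrite -big_distrr -big_distrl /= sum_euclid_basis sum_basisl // sum_basisr //.
by ring.
Qed.

(** The traceless Ricci part is scaled by [1 + (n - 2) b] and the scalar part by [1 + 2 (n - 1) a];
    the second term corrects for applying the first factor to all of [Ric S]. *)
Lemma Ric_ell a b S x z : (0 < n)%N -> curvature_tensor S ->
  Ric (ell a b S) x z = (1 + (n%:R - 2) * b) * Ric S x z
    + n%:R^-1 * (2 * (n%:R - 1) * a - (n%:R - 2) * b) * scal S * euclid x z.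
Proof.
move=> n0 [[lS _ _ _] _].
have nR : n%:R != 0 :> R by rewrite pnatr_eq0 -lt0n.
have eb := @euclid_bilinear R n.
have -> : Ric (ell a b S) x z = Ric S x z
    + b * Ric (kulkarni_nomizu (Ric S) (@euclid R n)) x z
    + n%:R^-1 * (a - b) * scal S
      * Ric (kulkarni_nomizu (@euclid R n) (@euclid R n)) x z.
  by rewrite /Ric 2!big_distrr -2!big_split.
rewrite !Ric_kulkarni_nomizu //; last exact: Ric_bilinear.
rewrite sum_euclid_basis -/(scal S); field; exact: nR.
Qed.

Lemma scal_ell a b S : (0 < n)%N -> curvature_tensor S ->
  scal (ell a b S) = (1 + 2 * (n%:R - 1) * a) * scal S.
Proof.
move=> n0 cS; have nR : n%:R != 0 :> R by rewrite pnatr_eq0 -lt0n.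
rewrite {1}/scal; under eq_bigr do rewrite Ric_ell //.
rewrite big_split /= -!big_distrr /= sum_euclid_basis -/(scal S).
by field; exact: nR.
Qed.

(** The parameters on the right say that the scaling factors [1 + 2 (n - 1) a] and [1 + (n - 2) b]
    multiply under composition. *)
Lemma ell_comp a b a' b' S : (0 < n)%N -> curvature_tensor S ->
  ell a b (ell a' b' S) =
    ell (a + a' + 2 * (n%:R - 1) * a * a') (b + b' + (n%:R - 2) * b * b') S.
Proof.
move=> n0 cS; have nR : n%:R != 0 :> R by rewrite pnatr_eq0 -lt0n.
apply/funext => x; apply/funext => y; apply/funext => z; apply/funext => w.
rewrite {1}/ell scal_ell // /kulkarni_nomizu !Ric_ell // /ell /kulkarni_nomizu.
field; exact: nR.
Qed.

End Curvature.

(** Serves to sum inequalities known only for distinct frame vectors: the full double sum has a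
    closed form, and the uncontrolled diagonal is moved to the other side. *)
Lemma sum_diag_le (R : realType) (F : nat -> nat -> R) (m k : nat) :
  (forall p q, (m <= p < k)%N -> (m <= q < k)%N -> p != q -> 0 <= F p q) ->
  \sum_(m <= p < k) F p p <= \sum_(m <= p < k) \sum_(m <= q < k) F p q.
Proof.
move=> F0; rewrite big_nat [leRHS]big_nat; apply: ler_sum => p pI.
rewrite (bigD1_seq p) ?iota_uniq ?mem_index_iota //= lerDl.
rewrite big_seq_cond sumr_ge0 // => q; rewrite mem_index_iota => /andP[qI qp].
by rewrite F0 // eq_sym.
Qed.

(** * Curvature bounds from PIC and from Ricci pinching *)

Section Pinching.
Variables (R : realType) (n : nat).
Implicit Types (x y z w : 'rV[R]_n) (S T U : form4 R n).
Implicit Types (e : nat -> 'rV[R]_n).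

(** The coefficients are the components of the two-form [phi] obtained by adding the wedge of [x],
    [y] and the wedge of [z], [w]. *)
Lemma bilinear2_wedge (f : form2 R n) x y z w : bilinear2 f ->
  \sum_(i < n) \sum_(j < n)
    (x 0 i * y 0 j - y 0 i * x 0 j + z 0 i * w 0 j - w 0 i * z 0 j)
    * f (basis R i) (basis R j) = f x y - f y x + f z w - f w z.
Proof.
move=> bf; rewrite !(bilinear2E _ _ bf) -!sumrB -!big_split /= -!sumrB.
apply: eq_bigr => i _; rewrite -!sumrB -!big_split /= -!sumrB.
apply: eq_bigr => j _; ring.
Qed.

Lemma bilinear2_comb (f : form2 R n) x y a b : bilinear2 f ->
  f (a *: x + b *: y) (a *: x + b *: y) =
    a ^+ 2 * f x x + a * b * (f x y + f y x) + b ^+ 2 * f y y.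
Proof.
move=> [fl fr].
rewrite (scalar_formD _ _ (fl _)) !(scalar_formZ _ _ (fl _)).
rewrite !(scalar_formD _ _ (fr _)) !(scalar_formZ _ _ (fr _)); ring.
Qed.

(** [T >= 0] is tested on the real two-form of [bilinear2_wedge]; the sum over all index pairs is
    four times the stated expression. *)
Lemma tensor_nonneg_wedge T x y z w : curvature_like T -> tensor_nonneg T ->
  0 <= T x y x y + 2 * T x y z w + T z w z w.
Proof.
move=> [[l1 l2 l3 l4] sa sb sc] T0.
pose P : 'M[R]_n := \matrix_(i, j)
  (x 0 i * y 0 j - y 0 i * x 0 j + z 0 i * w 0 j - w 0 i * z 0 j).
have PT : (map_mx (real_complex R) P)^T = - map_mx (real_complex R) P.
  apply/matrixP => i j; rewrite !mxE -rmorphN /=.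
  by congr (real_complex R _); ring.
have PE i j : map_mx (real_complex R) P i j = real_complex R (P i j).
  by rewrite mxE.
have cjE (r : R) : Num.conj (real_complex R r) = real_complex R r.
  exact: conjc_real.
have := T0 _ PT.
(* Since [P] is real, conjugation acts trivially and the complex sum is the image of a real one. *)
rewrite (_ : \sum_i _ = real_complex R (\sum_(i < n) \sum_(j < n)
    P i j * (\sum_(k < n) \sum_(l < n) P k l
      * T (basis R i) (basis R j) (basis R k) (basis R l)))); last first.
  rewrite rmorph_sum; apply: eq_bigr => i _.
  rewrite rmorph_sum; apply: eq_bigr => j _.
  rewrite rmorphM rmorph_sum big_distrr; apply: eq_bigr => k _ /=.
  rewrite rmorph_sum big_distrr; apply: eq_bigr => l _ /=.
  by rewrite !PE cjE rmorphM mulrA.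
rewrite -[0]/(real_complex R 0) lecR.
have bT u v : bilinear2 (T u v) by split=> t; [exact: l3|exact: l4].
under eq_bigr => i _ do under eq_bigr => j _ do
  [under eq_bigr => k _ do under eq_bigr => l _ do rewrite mxE;
   rewrite bilinear2_wedge // mxE].
(* The last two slots are now contracted with the two-form; [g] is what remains to be contracted in
   the first two. *)
pose g u v := T u v x y - T u v y x + T u v z w - T u v w z.
have bg : bilinear2 g.
  split=> [v a s t|u a s t] /=; rewrite /g.
    by rewrite !(l1 _ _ _ a s t); ring.
  by rewrite !(l2 _ _ _ a s t); ring.
rewrite (bilinear2_wedge x y z w bg) /g.
rewrite !(sa y x) !(sa w z) !(sb _ _ y x) !(sb _ _ w z) (sc z w x y); lra.
Qed.

(** The PIC expression of [T] is the sum of the two values of [tensor_nonneg_wedge] at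
    [e1, e3, e4, e2] and at [e1, e4, e2, e3]. *)
Lemma PIC_add_nonneg S T : curvature_like T -> tensor_nonneg T ->
  PIC (form4_sub S T) -> PIC S.
Proof.
move=> cT T0 ST e oe; have := ST e oe; rewrite /at4 /form4_sub.
have := tensor_nonneg_wedge (e 1%N) (e 3%N) (e 4%N) (e 2%N) cT T0.
have := tensor_nonneg_wedge (e 1%N) (e 4%N) (e 2%N) (e 3%N) cT T0.
have [_ sa sb _] := cT.
by rewrite (sa (e 4%N) (e 2%N)) (sb (e 2%N) _ (e 4%N)); lra.
Qed.

(** The entry at index 0 is a filler, because frames are numbered from 1. *)
Definition frame4 x y z w : nat -> 'rV[R]_n := nth 0 [:: 0; x; y; z; w].

Lemma orthonormal_frame4 x y z w :
  [/\ euclid x x = 1, euclid y y = 1, euclid z z = 1 & euclid w w = 1] ->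
  [/\ euclid x y = 0, euclid x z = 0 & euclid x w = 0] ->
  [/\ euclid y z = 0, euclid y w = 0 & euclid z w = 0] ->
  orthonormal_frame 4 (frame4 x y z w).
Proof.
move=> [xx yy zz ww] [xy xz xw] [yz yw zw].
by move=> [|[|[|[|[|i]]]]] [|[|[|[|[|j]]]]] //= _ _; rewrite // euclidC.
Qed.

(** By the first Bianchi identity, [U_1342 + U_1423 = - U_1234]. *)
Lemma PIC_isotropic U x y z w : curvature_tensor U -> PIC U ->
  orthonormal_frame 4 (frame4 x y z w) ->
  0 <= U x z x z + U x w x w + U y z y z + U y w y w - 2 * U x y z w.
Proof.
move=> [[_ sa sb sc] bU] picU /picU; rewrite /at4 /=.
have := bU w z y x.
rewrite (sc w z) (sa y x) (sb _ _ w z) (sc z y) (sa w x) (sb _ _ z y).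
rewrite (sc y w) (sa z x) (sb _ _ y w).
by have := sa x y z w; have := sc x z w y; lra.
Qed.


(** Exchanging [x] and [y] flips the sign of the mixed term; the two inequalities are averaged. *)
Lemma PIC_sectional U x y z w : curvature_tensor U -> PIC U ->
  orthonormal_frame 4 (frame4 x y z w) ->
  0 <= U x z x z + U x w x w + U y z y z + U y w y w.
Proof.
move=> cU picU o4; have [[_ sa _ _] _] := cU.
have o4' : orthonormal_frame 4 (frame4 y x z w).
  have E i j (i4 : (0 < i <= 4)%N) (j4 : (0 < j <= 4)%N) := o4 i j i4 j4.
  have := (E 1 1 isT isT, E 1 2 isT isT, E 1 3 isT isT, E 1 4 isT isT,
    E 2 2 isT isT, E 2 3 isT isT, E 2 4 isT isT,
    (E 3 3 isT isT, E 3 4 isT isT, E 4 4 isT isT))%N.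
  move=> /= [[[[[[[xx xy] xz] xw] yy] yz] yw] [[zz zw] ww]].
  by apply: orthonormal_frame4; split; rewrite // euclidC.
have := PIC_isotropic cU picU o4; have := PIC_isotropic cU picU o4'.
by rewrite (sa y x z w); lra.
Qed.

Variables (U : form4 R n) (e : nat -> 'rV[R]_n).
Hypotheses (cU : curvature_tensor U) (picU : PIC U).
Hypotheses (n5 : (5 <= n)%N) (oe : orthonormal_frame n e).

Let K (i j : nat) : R := U (e i) (e j) (e i) (e j).
Let r (i : nat) : R := Ric U (e i) (e i).

Let KC i j : K i j = K j i.
Proof. by have [[_ sa sb _] _] := cU; rewrite /K sa sb opprK. Qed.

Let Kii i : K i i = 0.
Proof.
have [[_ sa _ _] _] := cU.
by have := sa (e i) (e i) (e i) (e i); rewrite /K; lra.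
Qed.

Let rE i : r i = \sum_(1 <= p < n.+1) K i p.
Proof. by have [[lU _ _ _] _] := cU; rewrite /r (Ric_frame _ _ lU oe). Qed.

Let oe1 i : (1 <= i < n.+1)%N -> euclid (e i) (e i) = 1.
Proof. by move=> iI; rewrite oe // eqxx. Qed.

Let oe0 i j : (1 <= i < n.+1)%N -> (1 <= j < n.+1)%N -> i != j ->
  euclid (e i) (e j) = 0.
Proof. by move=> iI jI /negPf ij; rewrite oe // ij. Qed.

(** [PIC_sectional] for [e1, e_q, e2, e_p] is summed over ordered pairs of distinct [p, q >= 3]. The
    coefficient of [K 1 2] arises as [(n - 2)(n - 3) - 2 (n - 3) + 2]: the constant term, then the
    corrections from the sums of [K 1 p] and [K 2 q], then those from the sum of [K p q]. *)
Lemma sectional_lower_bound :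
  0 <= (n%:R ^+ 2 - 7 * n%:R + 14) * K 1 2 + scal U + (n%:R - 5) * (r 1 + r 2).
Proof.
have [[lU _ _ _] _] := cU.
have /= := @sum_diag_le R (fun p q => K 1 2 + K p q + K 1 p + K 2 q) 3 n.+1.
have sumK i : \sum_(3 <= q < n.+1) K i q = r i - K i 1 - K i 2.
  rewrite rE [in RHS]big_ltn; last by lia.
  by rewrite [in RHS]big_ltn; [ring|lia].
have sumr : \sum_(3 <= q < n.+1) r q = scal U - r 1 - r 2.
  rewrite (scal_frame lU oe) [in RHS]big_ltn; last by lia.
  by rewrite [in RHS]big_ltn; [rewrite /r; ring|lia].
have cst c : \sum_(3 <= q < n.+1) c = (n%:R - 2) * c.
  by rewrite sumr_const_nat -[LHS]mulr_natl subSS natrB //; lia.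
have -> : \sum_(3 <= p < n.+1) \sum_(3 <= q < n.+1)
      (K 1 2 + K p q + K 1 p + K 2 q)
    = (n%:R - 2) ^+ 2 * K 1 2 + (scal U - r 1 - r 2)
      - (r 1 - K 1 2) - (r 2 - K 1 2)
      + (n%:R - 2) * (r 1 - K 1 2) + (n%:R - 2) * (r 2 - K 1 2).
  under eq_bigr => p _.
    rewrite !big_split /= !cst !sumK (KC p 1) (KC p 2); over.
  rewrite !big_split /= !sumrN -!big_distrr /= !cst !sumK sumr !Kii (KC 2 1).
  by ring.
have -> : \sum_(3 <= p < n.+1) (K 1 2 + K p p + K 1 p + K 2 p)
    = (n%:R - 2) * K 1 2 + (r 1 - K 1 2) + (r 2 - K 1 2).
  under eq_bigr => p _ do rewrite Kii.
  by rewrite !big_split /= !cst !sumK !Kii (KC 2 1); ring.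
suff P p q : (3 <= p < n.+1)%N -> (3 <= q < n.+1)%N -> p != q ->
    0 <= K 1 2 + K p q + K 1 p + K 2 q by move=> /(_ P); lra.
move=> /andP[p3 pn] /andP[q3 qn] pq.
have o4 : orthonormal_frame 4 (frame4 (e 1%N) (e q) (e 2%N) (e p)).
  by apply: orthonormal_frame4; split; (apply: oe1 || apply: oe0); lia.
have := PIC_sectional cU picU o4.
by rewrite -/(K 1 2) -/(K 1 p) -/(K q 2) -/(K q p) (KC q) (KC q p); lra.
Qed.

(* PIC for [e1, e2, e3, lam e4 + c e_p], averaged over the two signs of
   [c = +- sqrt (1 - lam^2)]. *)
Lemma isotropic_mixture (lam : R) (p : nat) : 0 <= lam <= 1 ->
  (5 <= p < n.+1)%N ->
  0 <= (K 1 3 + K 2 3) + lam ^+ 2 * (K 1 4 + K 2 4)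
       + (1 - lam ^+ 2) * (K 1 p + K 2 p)
       - 2 * lam * U (e 1%N) (e 2%N) (e 3%N) (e 4%N).
Proof.
move=> /andP[lam0 lam1] pI; have [[[l1 l2 l3 l4] sa sb sc] _] := cU.
have mu2 : Num.sqrt (1 - lam ^+ 2) ^+ 2 = 1 - lam ^+ 2.
  by rewrite sqr_sqrtr // subr_ge0 expr_le1.
set mu := Num.sqrt _ in mu2.
have [el er] := @euclid_bilinear R n.
have o3 i : (1 <= i < 4)%N ->
    euclid (e i) (e 4%N) = 0 /\ euclid (e i) (e p) = 0.
  by move=> iI; split; apply: oe0; lia.
have o4 c : c ^+ 2 = 1 - lam ^+ 2 ->
    orthonormal_frame 4
      (frame4 (e 1%N) (e 2%N) (e 3%N) (lam *: e 4%N + c *: e p)).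
  move=> c2.
  have oc i : (1 <= i < 4)%N -> euclid (e i) (lam *: e 4%N + c *: e p) = 0.
    move=> iI; have [i4 ip] := o3 i iI.
    by rewrite (scalar_formD _ _ (er _)) !(scalar_formZ _ _ (er _)) i4 ip; ring.
  have cc : euclid (lam *: e 4%N + c *: e p) (lam *: e 4%N + c *: e p) = 1.
    rewrite (bilinear2_comb _ _ _ _ (@euclid_bilinear R n)).
    by rewrite c2 !oe1 ?[euclid (e p) _]euclidC ?oe0; try lia; ring.
  by apply: orthonormal_frame4; split; rewrite ?oc ?cc //;
    (apply: oe1 || apply: oe0); lia.
have b24 x : bilinear2 (fun y w => U x y x w).
  by split=> [w|y]; [apply: l2|apply: l4].
have exp4 c :=
  scalar_formD (lam *: e 4%N) (c *: e p) (l4 (e 1%N) (e 2%N) (e 3%N)).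
have := PIC_isotropic cU picU (o4 mu mu2).
have nmu2 : (- mu) ^+ 2 = 1 - lam ^+ 2 by rewrite sqrrN.
have := PIC_isotropic cU picU (o4 (- mu) nmu2).
have ex x c := bilinear2_comb (e 4%N) (e p) lam c (b24 x).
rewrite !ex !exp4 !(scalar_formZ _ _ (l4 _ _ _)) nmu2 mu2 /K; lra.
Qed.

(** Sum of [isotropic_mixture] over the [n - 4] indices [p >= 5]. *)
Lemma isotropic_lower_bound (lam : R) : 0 <= lam <= 1 ->
  0 <= (n%:R - 4) * ((K 1 3 + K 2 3) + lam ^+ 2 * (K 1 4 + K 2 4)
                     - 2 * lam * U (e 1%N) (e 2%N) (e 3%N) (e 4%N))
       + (1 - lam ^+ 2) * (r 1 + r 2 - 2 * K 1 2).
Proof.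
move=> lamI.
have lam2 : 0 <= 1 - lam ^+ 2.
  by case/andP: lamI => lam0 lam1; rewrite subr_ge0 expr_le1.
have sumK i : \sum_(5 <= q < n.+1) K i q
    = r i - K i 1 - K i 2 - K i 3 - K i 4.
  rewrite rE [in RHS]big_ltn; last by lia.
  rewrite [in RHS]big_ltn; last by lia.
  rewrite [in RHS]big_ltn; last by lia.
  by rewrite [in RHS]big_ltn; [ring|lia].
have : 0 <= \sum_(5 <= p < n.+1) (((K 1 3 + K 2 3) + lam ^+ 2 * (K 1 4 + K 2 4)
    - 2 * lam * U (e 1%N) (e 2%N) (e 3%N) (e 4%N))
    + (1 - lam ^+ 2) * (K 1 p + K 2 p)).
  rewrite big_nat sumr_ge0 // => p pI.
  by have := isotropic_mixture lamI pI; lra.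
rewrite big_split /= sumr_const_nat -[_ *+ _]mulr_natl -big_distrr big_split /=.
rewrite !sumK !Kii (KC 2 1) subSS natrB; last by lia.
have o4 : orthonormal_frame 4 (frame4 (e 1%N) (e 2%N) (e 3%N) (e 4%N)).
  by apply: orthonormal_frame4; split; (apply: oe1 || apply: oe0); lia.
have := mulr_ge0 lam2 (PIC_sectional cU picU o4).
by rewrite -/(K 1 3) -/(K 1 4) -/(K 2 3) -/(K 2 4); lra.
Qed.

(** Summing the hypothesis over ordered pairs of distinct indices gives
    [2 (n - 1)(1 + g) scal U >= 0]. *)
Lemma pinched_scal_ge0 (g : R) : 0 <= g ->
  (forall i j, (1 <= i < n.+1)%N -> (1 <= j < n.+1)%N -> i != j ->
    0 <= r i + r j + 2 * g / n%:R * scal U) ->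
  0 <= scal U.
Proof.
move=> g0 /sum_diag_le; have [[lU _ _ _] _] := cU.
have n0 : n%:R != 0 :> R by rewrite pnatr_eq0; lia.
have cst c : \sum_(1 <= q < n.+1) c = n%:R * c.
  by rewrite sumr_const_nat subn1 mulr_natl.
under [X in _ <= X -> _]eq_bigr do
  rewrite !big_split /= !cst -(scal_frame lU oe).
rewrite !big_split /= -!big_distrr /= !cst -(scal_frame lU oe).
have n1 : 0 < n%:R - 1 :> R by rewrite subr_gt0 ltr1n; lia.
have -> : 2 * g / n%:R * (n%:R * scal U) = 2 * g * scal U by field.
move=> H; have : 0 <= (2 * (n%:R - 1) * (1 + g)) * scal U by lra.
by rewrite pmulr_rge0 // !mulr_gt0 //; lra.
Qed.

End Pinching.

(** * Inequalities between explicit functions of the dimension *)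

Section Arithmetic.
Variable R : realType.

(* Works when all the coefficients in powers of [x] are nonnegative: [lra]
   treats these powers as independent variables. *)
Ltac shifted_poly x0 :=
  let h := fresh in
  have h k := exprn_ge0 k x0;
  move: (h 2) (h 3) (h 4) (h 5) (h 6) (h 7) (h 8) (h 9) (h 10) (h 11);
  clear h; lra.

(* Sufficient conditions on [S = ell a b U], with [q] for [sqrt (2 * tilde_a)]
   and [g] for [coneC_gamma], for the last clause of [tilde_coneE]: the second
   is the worst case [lam = 1]; the third makes the coefficient of
   [Ric_11 + Ric_22] nonnegative; the fourth is the worst case
   [Ric_11 + Ric_22 = - 2 g scal / n] at [lam = 0]. *)
Definition admissible (N g q a b : R) : Prop :=
  [/\ 0 <= b, 0 <= a - b * (1 + g),
      (N - 1) / (N ^+ 2 - 7 * N + 14) <= q * (1 + (N - 2) * b)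
    & 0 <= q * (4 * (N - 1) * a - 2 * (N - 2) * b
                - 2 * g * (1 + (N - 2) * b))
           + 2 * g * ((N - 1) / (N ^+ 2 - 7 * N + 14))
           - 2 * N / ((N ^+ 2 - 7 * N + 14) * (N - 4))
           + 4 * (a - b * (1 + g))].

(** Here [sg] stands for [scal U / n], [ri] for the Ricci curvatures of [U], [k] for [U_1212], and
    [X] for the part of the isotropic expression without Ricci terms; the conclusion is the last
    clause of [tilde_coneE] for [ell a b U]. *)
Lemma admissible_combination N g q a b sg lam X k r1 r2 r3 r4 :
  12 <= N -> admissible N g q a b -> 0 <= sg -> 0 <= lam <= 1 ->
  [/\ 0 <= r1 + r2 + 2 * g * sg, 0 <= r1 + r3 + 2 * g * sg,
      0 <= r2 + r3 + 2 * g * sg, 0 <= r1 + r4 + 2 * g * sg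
    & 0 <= r2 + r4 + 2 * g * sg] ->
  0 <= (N - 4) * X + (1 - lam ^+ 2) * (r1 + r2 - 2 * k) ->
  0 <= (N ^+ 2 - 7 * N + 14) * k + N * sg + (N - 5) * (r1 + r2) ->
  0 <= X + b * (r1 + r2 + 2 * r3 + lam ^+ 2 * (r1 + r2 + 2 * r4))
       + 4 * sg * (a - b) * (1 + lam ^+ 2)
       + q * (1 - lam ^+ 2) * ((1 + (N - 2) * b) * (r1 + r2)
                               + sg * (4 * (N - 1) * a - 2 * (N - 2) * b)).
Proof.
move=> N12 [b0 C1 C2 C3] sg0 /andP[lam0 lam1] [s0 r13 r23 r14 r24] HX Hk.
have mu0 : 0 <= 1 - lam ^+ 2 by rewrite subr_ge0 expr_le1.
have lam2 : 0 <= lam ^+ 2 by rewrite sqr_ge0.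
have D0 : 0 < N ^+ 2 - 7 * N + 14 by nra.
have N4 : 0 < N - 4 by lra.
set kp := 1 + (N - 2) * b in C2 C3 *.
set A := 4 * (N - 1) * a - 2 * (N - 2) * b in C3 *.
set ka := (N - 1) / _ in C2 C3.
set V := 2 * N / _ in C3.
(* Eliminates [k] between [HX] and [Hk]. With [D = N^2 - 7 N + 14], the form of [ka] comes from
   [D + 2 (N - 5) = (N - 1)(N - 4)]. *)
have HX' : 0 <= X + (1 - lam ^+ 2) * (ka * (r1 + r2) + V * sg).
  rewrite -(pmulr_rge0 _ (mulr_gt0 D0 N4)).
  have -> : (N ^+ 2 - 7 * N + 14) * (N - 4)
      * (X + (1 - lam ^+ 2) * (ka * (r1 + r2) + V * sg))
    = (N ^+ 2 - 7 * N + 14)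
        * ((N - 4) * X + (1 - lam ^+ 2) * (r1 + r2 - 2 * k))
      + 2 * ((1 - lam ^+ 2) * ((N ^+ 2 - 7 * N + 14) * k + N * sg
                               + (N - 5) * (r1 + r2))).
    by rewrite /ka /V; field; rewrite !gt_eqF.
  by rewrite addr_ge0 ?mulr_ge0 // ltW.
have H3 : 0 <= b * (r1 + r2 + 2 * r3 + 4 * g * sg) by rewrite mulr_ge0 //; lra.
have H4 : 0 <= lam ^+ 2 * (b * (r1 + r2 + 2 * r4 + 4 * g * sg)).
  by rewrite !mulr_ge0 //; lra.
have Hs : 0 <= (1 - lam ^+ 2) * ((q * kp - ka) * (r1 + r2 + 2 * g * sg)).
  by rewrite !mulr_ge0 // subr_ge0.
(* After [HX'], [H3], [H4] and [Hs] only a multiple of [sg] remains: [1 - lam^2] times the fourth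
   condition plus [8 lam^2] times the second. *)
have H5 := mulr_ge0 mu0 (mulr_ge0 sg0 C3).
have H6 := mulr_ge0 (mulr_ge0 lam2 sg0) C1.
lra.
Qed.

Lemma admissible12 (q : R) :
  let be : R := 1 / 115 in let al : R := (2 * be + 10 * be ^+ 2) / 2 in
  q ^+ 2 = 2 * al -> 0 <= q ->
  admissible 12 (105^-1) q
    ((106 ^+ 2 / (96 * 12 ^+ 2 * 35) - al) / (1 + 2 * 11 * al))
    ((48^-1 - be) / (1 + 10 * be)).
Proof.
move=> be al q2 q0.
have alE : al = 24 / 2645 by rewrite /al /be; field.
(* A rational lower bound for [sqrt (48 / 2645) = 0.13471...], after which the conditions are linear
   in [q]. *)
have q1 : 1347 / (100 * 100) <= q.
  rewrite -(ler_pXn2r (n := 2)) ?nnegrE //; last by lra.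
  by rewrite q2 alE; lra.
have -> : (48^-1 - be) / (1 + 10 * be) = 67 / 6000 by rewrite /be; field.
have -> : (106 ^+ 2 / (96 * 12 ^+ 2 * 35) - al) / (1 + 2 * 11 * al)
    = (905 * 1000 + 353) / (24 * 1008 * 3173) by rewrite alE; field.
have DE : 12 ^+ 2 - 7 * 12 + 14 = 74 :> R by ring.
have VE : 2 * 12 / (74 * (12 - 4)) = 3 / 74 :> R by field.
rewrite /admissible DE VE; split; lra.
Qed.

(** With [m = n - 6] all parameters are rational functions of [m], and each condition reduces to the
    sign of a polynomial. *)
Lemma admissible13 (m q : R) : 7 <= m ->
  let N := m + 6 in let be := 1 / (3 * m ^+ 2) in
  let al := (2 * be + (N - 2) * be ^+ 2) / 2 in
  q ^+ 2 = 2 * al -> 0 <= q ->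
  admissible N (1 / (3 * (3 * m + 17))) q
    (((9 * m + 52) ^+ 2 / (96 * (m + 6) ^+ 2 * (3 * m + 17)) - al)
     / (1 + 2 * (N - 1) * al))
    ((1 / (4 * N) - be) / (1 + (N - 2) * be)).
Proof.
move=> m7 N be al q2 q0.
(* [B] and [P] are numerators of the two parameters of [ell]; [E] and [D4] are those of
   [1 + (N - 2) be] and [1 + 2 (N - 1) al]. *)
pose B := 3 * m ^+ 2 - 4 * m - 24.
pose E := 3 * m ^+ 2 + m + 4.
pose D4 := 9 * m ^+ 4 + (m + 5) * (6 * m ^+ 2 + m + 4).
pose P := 3 * m ^+ 4 * (9 * m + 52) ^+ 2
          - 16 * (m + 6) ^+ 2 * (3 * m + 17) * (6 * m ^+ 2 + m + 4).
(* Expanding at [m = 7] makes all coefficients nonnegative, as [shifted_poly] requires. *)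
have [x x0 mE] : exists2 x, 0 <= x & m = x + 7 by exists (m - 7); lra.
have m0 : 0 < m by lra.
have m6 : 0 < m + 6 by lra.
have m2 : 0 < m + 2 by lra.
have m17 : 0 < 3 * m + 17 by lra.
have B0 : 0 < B by rewrite /B mE; shifted_poly x0.
have E0 : 0 < E by rewrite /E mE; shifted_poly x0.
have D40 : 0 < D4 by rewrite /D4 mE; shifted_poly x0.
have D0 : 0 < m ^+ 2 + 5 * m + 8 by rewrite mE; shifted_poly x0.
(* [C1] is the second condition and [C2] the square of the third; [C3] and [C4] yield [W0] and [key]
   for the fourth. *)
have C1 : 0 <= 3 * P * E - 8 * (m + 6) * B * (9 * m + 52) * D4.
  by rewrite /P /E /B /D4 mE; shifted_poly x0.
have C2 : 0 <= (6 * m ^+ 2 + m + 4) * (5 * m + 28) ^+ 2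
                 * (m ^+ 2 + 5 * m + 8) ^+ 2
               - 16 * (m + 6) ^+ 2 * E ^+ 2 * (m + 5) ^+ 2.
  by rewrite /E mE; shifted_poly x0.
have C3 : 0 <= (m + 5) * P * E - 4 * (m + 6) * (3 * m + 17) * (m + 4) * B * D4
               - 4 * (m + 6) * (5 * m + 28) * m ^+ 2 * D4.
  by rewrite /P /E /B /D4 mE; shifted_poly x0.
have C4 : 0 <= (m + 5) * (m + 2)
      * ((m + 5) * P * E - 4 * (m + 6) * (3 * m + 17) * (m + 4) * B * D4)
    - 12 * m ^+ 2 * (5 * m + 28) * (m + 6) ^+ 2 * (3 * m + 17) * D4.
  by rewrite /P /E /B /D4 mE; shifted_poly x0.
have {x x0 mE} nz : [/\ m != 0, m + 6 != 0, 3 * m + 17 != 0, E != 0 & D4 != 0].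
  by rewrite !gt_eqF.
case: nz => mn m6n m17n En D4n.
have bE : (1 / (4 * N) - be) / (1 + (N - 2) * be) = B / (4 * (m + 6) * E).
  have -> : 1 + (N - 2) * be = E / (3 * m ^+ 2) by rewrite /N /be /E; field.
  by rewrite /N /be /B; field; rewrite m6n mn En.
have aE : ((9 * m + 52) ^+ 2 / (96 * (m + 6) ^+ 2 * (3 * m + 17)) - al)
     / (1 + 2 * (N - 1) * al) = P / (32 * (m + 6) ^+ 2 * (3 * m + 17) * D4).
  have -> : al = (6 * m ^+ 2 + m + 4) / (18 * m ^+ 4).
    by rewrite /al /be /N; field.
  have -> : 1 + 2 * (N - 1) * ((6 * m ^+ 2 + m + 4) / (18 * m ^+ 4))
      = D4 / (9 * m ^+ 4) by rewrite /N /D4; field.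
  by rewrite /P; field; rewrite m6n m17n mn D4n.
have ND : N ^+ 2 - 7 * N + 14 = m ^+ 2 + 5 * m + 8 by rewrite /N; ring.
have kE : 1 + (N - 2) * (B / (4 * (m + 6) * E))
    = 3 * m ^+ 2 * (5 * m + 28) / (4 * (m + 6) * E).
  by rewrite /N /B /E; field; rewrite m6n -/E En.
have k0 : 0 < 3 * m ^+ 2 * (5 * m + 28) / (4 * (m + 6) * E).
  by rewrite divr_gt0 ?mulr_gt0 ?exprn_gt0 //; lra.
have qk : (N - 1) / (m ^+ 2 + 5 * m + 8)
    <= q * (3 * m ^+ 2 * (5 * m + 28) / (4 * (m + 6) * E)).
  have l0 : 0 <= (N - 1) / (m ^+ 2 + 5 * m + 8).
    by rewrite divr_ge0 ?ltW // /N; lra.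
  have r0 : 0 <= q * (3 * m ^+ 2 * (5 * m + 28) / (4 * (m + 6) * E)).
    by rewrite mulr_ge0 // ltW.
  rewrite -(ler_pXn2r (n := 2)) ?nnegrE //.
  rewrite [leRHS]exprMn q2 -subr_ge0.
  have -> : 2 * al * (3 * m ^+ 2 * (5 * m + 28) / (4 * (m + 6) * E)) ^+ 2
      - ((N - 1) / (m ^+ 2 + 5 * m + 8)) ^+ 2
    = ((6 * m ^+ 2 + m + 4) * (5 * m + 28) ^+ 2 * (m ^+ 2 + 5 * m + 8) ^+ 2
       - 16 * (m + 6) ^+ 2 * E ^+ 2 * (m + 5) ^+ 2)
      / (16 * (m + 6) ^+ 2 * E ^+ 2 * (m ^+ 2 + 5 * m + 8) ^+ 2).
    by rewrite /al /be /N; field; rewrite mn m6n En gt_eqF.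
  by rewrite divr_ge0 // !mulr_ge0 ?ler0n ?sqr_ge0 // ltW.
have c1 : 0 <= P / (32 * (m + 6) ^+ 2 * (3 * m + 17) * D4)
    - B / (4 * (m + 6) * E) * (1 + 1 / (3 * (3 * m + 17))).
  have -> : P / (32 * (m + 6) ^+ 2 * (3 * m + 17) * D4)
      - B / (4 * (m + 6) * E) * (1 + 1 / (3 * (3 * m + 17)))
    = (3 * P * E - 8 * (m + 6) * B * (9 * m + 52) * D4)
      / (96 * (m + 6) ^+ 2 * (3 * m + 17) * D4 * E).
    by field; rewrite m6n m17n En D4n.
  by rewrite divr_ge0 // !mulr_ge0 ?ler0n ?sqr_ge0 // ltW.
rewrite bE aE; split; rewrite ?ND ?kE //.
  by rewrite divr_ge0 ?mulr_ge0 ?ltW.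
set k := 3 * m ^+ 2 * _ / _ in kE k0 qk *.
set ka := (N - 1) / _ in qk *.
set V := 2 * N / _.
set W := _ - _ - _ * k.
have W0 : 0 <= W.
  have -> : W =
      ((m + 5) * P * E - 4 * (m + 6) * (3 * m + 17) * (m + 4) * B * D4
        - 4 * (m + 6) * (5 * m + 28) * m ^+ 2 * D4)
      / (8 * (m + 6) ^+ 2 * (3 * m + 17) * D4 * E).
    by rewrite /W /k /N; field; rewrite m6n m17n En D4n.
  by rewrite divr_ge0 // !mulr_ge0 ?ler0n ?sqr_ge0 // ltW.
(* The summand handled by [c1] is split off. The rest is multiplied by [k > 0]; since [W >= 0],
   [q * k] can then be replaced by its lower bound [ka], which leaves [key]. *)
apply: addr_ge0; last by rewrite mulr_ge0.
rewrite -(pmulr_rge0 _ k0).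
have key : 0 <= ka * W + 2 * (1 / (3 * (3 * m + 17))) * ka * k - V * k.
  have -> : ka * W + 2 * (1 / (3 * (3 * m + 17))) * ka * k - V * k =
    ((m + 5) * (m + 2)
      * ((m + 5) * P * E - 4 * (m + 6) * (3 * m + 17) * (m + 4) * B * D4)
    - 12 * m ^+ 2 * (5 * m + 28) * (m + 6) ^+ 2 * (3 * m + 17) * D4)
    / (8 * (m + 6) ^+ 2 * (3 * m + 17) * D4 * E
       * ((m ^+ 2 + 5 * m + 8) * (m + 2))).
    rewrite /ka /W /V /k /N; field.
    by rewrite (gt_eqF m2) (gt_eqF D0) En D4n m17n m6n.
  by rewrite divr_ge0 // !mulr_ge0 ?ler0n ?sqr_ge0 // ltW.
have : 0 <= (q * k - ka) * W by apply: mulr_ge0; rewrite // subr_ge0.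
lra.
Qed.

End Arithmetic.

(** * The actual parameters, and the equality of the two cones *)

Section Main.
Variables (R : realType) (n : nat).
Hypothesis (n12 : (12 <= n)%N).

Let N : R := n%:R.
Let be : R := tilde_b_max R n.
Let al : R := tilde_a n be.
Let b : R := b_max R n.
Let a : R := coneC_a n b.
Let g : R := coneC_gamma n b.
(** [a'] and [b'] solve the parameter equations of [ell_comp], so that [ell al be] after [ell a' b']
    is [ell a b]. *)
Let b' : R := (b - be) / (1 + (N - 2) * be).
Let a' : R := (a - al) / (1 + 2 * (N - 1) * al).

Let N12 : 12 <= N.
Proof. by rewrite /N ler_nat. Qed.

Let be_gt0 : 0 < be.
Proof.
have ? := N12; rewrite /be /tilde_b_max -/N.
case: ifP => [_|_]; first by lra.
by rewrite divr_gt0 ?mulr_gt0 ?exprn_gt0 //; lra.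
Qed.

Let al_gt0 : 0 < al.
Proof.
have ? := N12; have ? := be_gt0.
rewrite /al /tilde_a -/N divr_gt0 // addr_gt0 ?mulr_gt0 ?exprn_gt0 //; lra.
Qed.

Let aE : a = (9 * N - 2) ^+ 2 / (96 * N ^+ 2 * (3 * N - 1)).
Proof.
have ? := N12; rewrite /a /coneC_a /b /b_max -/N.
have N0 : N != 0 by rewrite gt_eqF //; lra.
have N1 : 3 * N - 1 != 0 by rewrite gt_eqF //; lra.
have -> : 2 + (N - 2) * (1 / (4 * N)) = (9 * N - 2) / (4 * N) by field.
have -> : 2 * (2 + (N - 3) * (1 / (4 * N))) = 3 * (3 * N - 1) / (2 * N).
  by field.
by field; rewrite N0 N1.
Qed.

Let gE : g = 1 / (3 * (3 * N - 1)).
Proof.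
have ? := N12; rewrite /g /coneC_gamma /b /b_max -/N.
have N0 : N != 0 by rewrite gt_eqF //; lra.
have N1 : 3 * N - 1 != 0 by rewrite gt_eqF //; lra.
have -> : 2 + (N - 3) * (1 / (4 * N)) = 3 * (3 * N - 1) / (4 * N) by field.
by field; rewrite N0 N1.
Qed.

Lemma tilde_admissible : admissible N g (Num.sqrt (2 * al)) a' b'.
Proof.
have ? := N12; have ? := al_gt0.
have q0 := sqrtr_ge0 (2 * al).
have q2 : Num.sqrt (2 * al) ^+ 2 = 2 * al by rewrite sqr_sqrtr //; lra.
move: q0 q2; set q := Num.sqrt _; rewrite /a' /b' aE gE /b /b_max -/N.
have [nE|n13] := eqVneq n 12%N.
  have NE : N = 12 by rewrite /N nE.
  have beE : be = 1 / 115 by rewrite /be /tilde_b_max nE eqxx.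
  have alE : al = (2 * (1 / 115) + 10 * (1 / 115) ^+ 2) / 2.
    by rewrite /al /tilde_a -/N NE beE; congr (_ / _); ring.
  rewrite alE => q0 q2; have := admissible12 q2 q0; rewrite beE NE.
  have -> : 1 / (3 * (3 * 12 - 1)) = 105^-1 :> R by field.
  have -> : (9 * 12 - 2) = 106 :> R by ring.
  have -> : (3 * 12 - 1) = 35 :> R by ring.
  have -> : (12 - 1) = 11 :> R by ring.
  have -> : (12 - 2) = 10 :> R by ring.
  have -> : 1 / (4 * 12) = 48^-1 :> R by field.
  by [].
have beE : be = 1 / (3 * (N - 6) ^+ 2).
  by rewrite /be /tilde_b_max (negPf n13).
have m7 : 7 <= N - 6 by rewrite lerBrDr -natrD ler_nat; lia.
move=> q0 q2; have := @admissible13 R (N - 6) q m7.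
have -> : N - 6 + 6 = N by ring.
have -> : 9 * (N - 6) + 52 = 9 * N - 2 by ring.
have -> : 3 * (N - 6) + 17 = 3 * N - 1 by ring.
by rewrite -beE => /(_ q2 q0).
Qed.

Lemma ell_ell S :
  curvature_tensor S -> ell al be (@ell R n a' b' S) = ell a b S.
Proof.
have ? := N12; have ? := be_gt0; have ? := al_gt0.
move=> cS; rewrite ell_comp //; last by lia.
have d1 : 1 + (N - 2) * be != 0.
  by rewrite gt_eqF // ltr_wpDr // mulr_ge0 ?ltW //; lra.
have d2 : 1 + 2 * (N - 1) * al != 0.
  by rewrite gt_eqF // ltr_wpDr // mulr_ge0 // ?ltW; lra.
by congr (ell _ _ S); rewrite -/N /a' /b'; field.
Qed.

Lemma ell_sectional c d (S : form4 R n) x y :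
  euclid x x = 1 -> euclid y y = 1 -> euclid x y = 0 ->
  ell c d S x y x y =
    S x y x y + d * (Ric S x x + Ric S y y) + 2 * (c - d) * (scal S / N).
Proof.
move=> xx yy xy; rewrite /ell /kulkarni_nomizu (euclidC y x) xx yy xy -/N; ring.
Qed.

(** Every term of both Kulkarni-Nomizu products contains an inner product of [x] or [y] with [z] or
    [w]. *)
Lemma ell_orthogonal c d (S : form4 R n) x y z w :
  euclid x z = 0 -> euclid x w = 0 -> euclid y z = 0 -> euclid y w = 0 ->
  ell c d S x y z w = S x y z w.
Proof.
by move=> xz xw yz yw; rewrite /ell /kulkarni_nomizu xz xw yz yw; ring.
Qed.

Lemma pinched_ell_ge0 (S U : form4 R n) (e : nat -> 'rV[R]_n) (lam : R) :
  curvature_tensor U -> PIC U ->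
  (forall e, orthonormal_frame 2 e ->
     0 <= at2 (Ric U) e 1 1 + at2 (Ric U) e 2 2 + 2 * g / N * scal U) ->
  orthonormal_frame n e -> 0 <= lam <= 1 -> S = ell a' b' U ->
  0 <= at4 S e 1 3 1 3 + lam ^+ 2 * at4 S e 1 4 1 4
       + at4 S e 2 3 2 3 + lam ^+ 2 * at4 S e 2 4 2 4
       - 2 * lam * at4 S e 1 2 3 4
       + Num.sqrt (2 * al) * (1 - lam ^+ 2)
         * (at2 (Ric S) e 1 1 + at2 (Ric S) e 2 2).
Proof.
have ? := N12; move=> cU picU ric oe lamI ->.
have n5 : (5 <= n)%N by apply: leq_trans n12.
have n0 : (0 < n)%N by apply: leq_trans n12.
have le4 i : (1 <= i < 5)%N -> (1 <= i < n.+1)%N.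
  by case/andP=> i1 i5; rewrite i1 (leq_trans i5) // ltnW.
have oe1 i : (1 <= i < n.+1)%N -> euclid (e i) (e i) = 1.
  by move=> iI; rewrite oe // eqxx.
have oe0 i j : (1 <= i < n.+1)%N -> (1 <= j < n.+1)%N -> i != j ->
    euclid (e i) (e j) = 0.
  by move=> iI jI /negPf ij; rewrite oe // ij.
have g0 : 0 <= g by rewrite gE divr_ge0 //; lra.
have ric_e i j : (1 <= i < n.+1)%N -> (1 <= j < n.+1)%N -> i != j ->
    0 <= Ric U (e i) (e i) + Ric U (e j) (e j) + 2 * g / N * scal U.
  move=> iI jI ij; apply: (ric (fun k => if k == 1%N then e i else e j)).
  by move=> [|[|[|k]]] [|[|[|l]]] //= _ _; rewrite ?oe1 ?oe0 // eq_sym.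
have N0 : 0 < N by lra.
have scal0 := pinched_scal_ge0 cU n5 oe g0 ric_e.
have sg0 : 0 <= scal U / N by rewrite divr_ge0 // ltW.
have ric4 i j : (1 <= i < 5)%N -> (1 <= j < 5)%N -> i != j ->
    0 <= Ric U (e i) (e i) + Ric U (e j) (e j) + 2 * g * (scal U / N).
  move=> iI jI ij; rewrite mulrA -(mulrAC _ _ (scal U)).
  by apply: ric_e => //; apply: le4.
have HX := isotropic_lower_bound cU picU n5 oe lamI.
have Hk := sectional_lower_bound cU picU n5 oe.
rewrite -/N in HX Hk.
have scalE : N * (scal U / N) = scal U by field; rewrite gt_eqF.
(* Expresses [scal U] through [scal U / N], the quantity [sg] of [admissible_combination]. *)
rewrite -[in X in _ + X + _]scalE in Hk.
have := admissible_combination N12 tilde_admissible sg0 lamI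
  (And5 (ric4 1 2 isT isT isT) (ric4 1 3 isT isT isT) (ric4 2 3 isT isT isT)
        (ric4 1 4 isT isT isT) (ric4 2 4 isT isT isT))%N HX Hk.
have eij i j : (1 <= i < 5)%N -> (1 <= j < 5)%N -> i != j ->
    euclid (e i) (e j) = 0 by move=> iI jI ij; rewrite oe0 ?le4.
have eii i : (1 <= i < 5)%N -> euclid (e i) (e i) = 1.
  by move=> iI; rewrite oe1 ?le4.
rewrite /at4 /at2 !Ric_ell // !eii //.
rewrite (@ell_orthogonal _ _ _ (e 1%N) (e 2%N)) ?eij //.
rewrite !ell_sectional ?eii ?eij // -/N.
by set q := Num.sqrt _; congr (_ <= _); ring.
Qed.

End Main.

Theorem proposition4p3 (R : realType) (n : nat) (hn : (12 <= n)%N) :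
  @tilde_coneC R n (tilde_b_max R n) = @coneC R n (b_max R n).
Proof.
(* One inclusion is built into [tilde_coneE], which demands that [ell] of its elements lie in
   [coneC b_max]. *)
apply/seteqP; split=> [_ [S [_ CS _] <-] //|T CT].
have [U [cU [W [[cW W0] picUW ric _]]] UT] := CT.
have picU := PIC_add_nonneg cW W0 picUW.
exists (ell
  ((coneC_a n (b_max R n) - tilde_a n (tilde_b_max R n))
   / (1 + 2 * (n%:R - 1) * tilde_a n (tilde_b_max R n)))
  ((b_max R n - tilde_b_max R n) / (1 + (n%:R - 2) * tilde_b_max R n)) U);
  last by rewrite ell_ell.
split; [exact: ell_curvature|by rewrite ell_ell // UT|move=> e lam oe lamI].
have n4 : (4 <= n)%N by lia.
have [f oef fE] := orthonormal_frame_extend n4 oe.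
have := pinched_ell_ge0 hn cU picU ric oef lamI erefl.
by rewrite /at4 /at2 !fE.
Qed.
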